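(* Let $\mathcal{R}$ be a $\ast$-ring with identity. The 1MP-relation $\leq^{-\dagger}$ is a partial order on $\mathcal{R}^{\dagger}$.
   Context: A $\ast$-ring is an associative ring with an involution $\ast$, i.e. $(x^{\ast})^{\ast}=x$, $(x+y)^{\ast}=x^{\ast}+y^{\ast}$, $(xy)^{\ast}=y^{\ast}x^{\ast}$. The Moore-Penrose inverse $a^{\dagger}$ of $a\in\mathcal{R}$ is the (unique, if it exists) $x\in\mathcal{R}$ with $axa=a$, $xax=x$, $(ax)^{\ast}=ax$, $(xa)^{\ast}=xa$; $\mathcal{R}^{\dagger}$ is the set of all $a\in\mathcal{R}$ for which $a^{\dagger}$ exists. $a\{1\}=\{x\in\mathcal{R}: axa=a\}$. For $a\in\mathcal{R}^{\dagger}$, the set of 1MP-inverses of $a$ is $a\{-\dagger\}=\{a^{-}aa^{\dagger}: a^{-}\in a\{1\}\}$. For $a\in\mathcal{R}^{\dagger}$ and $b\in\mathcal{R}$, $a\leq^{-\dagger}b$ means that there exists $a^{-\dagger}\in a\{-\dagger\}$ such that $a^{-\dagger}a=a^{-\dagger}b$ and $aa^{-\dagger}=ba^{-\dagger}$. *)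

(* Defs.v *)
From mathcomp Require Import all_boot all_algebra.

Set Implicit Arguments.
Unset Strict Implicit.
Unset Printing Implicit Defensive.

Import GRing.Theory.
Local Open Scope ring_scope.

(* Rings are taken in [pzRingType]: associative, unital, not necessarily
   commutative, and possibly trivial. *)

Record ring_involution (R : pzRingType) (star : R -> R) : Prop :=
  RingInvolution {
    starK : forall x, star (star x) = x;
    starD : forall x y, star (x + y) = star x + star y;
    starM : forall x y, star (x * y) = star y * star x
  }.

Definition is_MP_inverse (R : pzRingType) (star : R -> R) (a x : R) : Prop :=
  [/\ a * x * a = a, x * a * x = x,
      star (a * x) = a * x & star (x * a) = x * a].

Definition MP_invertible (R : pzRingType) (star : R -> R) (a : R) : Prop :=
  exists x, is_MP_inverse star a x.

Definition is_inner_inverse (R : pzRingType) (a x : R) : Prop :=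
  a * x * a = a.

(* The Moore-Penrose inverse [d] is quantified existentially; it is unique
   when it exists, so [y] ranges over the elements a^- a a^dagger. No [y]
   satisfies this when [a] is not Moore-Penrose invertible. *)
Definition is_1MP_inverse (R : pzRingType) (star : R -> R) (a y : R) : Prop :=
  exists x d, [/\ is_inner_inverse a x, is_MP_inverse star a d & y = x * a * d].

Definition le_1MP (R : pzRingType) (star : R -> R) (a b : R) : Prop :=
  exists y, [/\ is_1MP_inverse star a y, y * a = y * b & a * y = b * y].

Definition partial_order_on (T : Type) (D : T -> Prop) (le : T -> T -> Prop) :
    Prop :=
  [/\ forall a, D a -> le a a,
      forall a b, D a -> D b -> le a b -> le b a -> a = b
    & forall a b c, D a -> D b -> D c -> le a b -> le b c -> le a c].

(* Main.v *)
(* For a in R^dagger, the 1MP-inverses of [a] are exactly its {1,2,3}-inverses: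
   the y with a y a = a, y a y = y and a y self-adjoint. If y witnesses a <= b and z
   witnesses b <= c, then (b z)(a y) = a y, and taking stars (a y)(b z) = a y,
   so a z = a y; hence z a y = z a z is a {1,2,3}-inverse of a, and it witnesses
   a <= c. *)

Require Import Defs.
From mathcomp Require Import all_boot all_algebra.

Import GRing.Theory.
Local Open Scope ring_scope.

(** Trades the existential quantifiers of [is_1MP_inverse] for three equations in [y] alone. *)
Definition is_123_inverse {R : pzRingType} (star : R -> R) (a y : R) : Prop :=
  [/\ a * y * a = a, y * a * y = y & star (a * y) = a * y].

Lemma is_1MP_inverse_123 {R : pzRingType} {star : R -> R} {a y : R} :
  is_1MP_inverse star a y -> is_123_inverse star a y.
Proof.
case=> x [d [axa [ada dad sad _] ->]].
have adE : a * (x * a * d) = a * d by rewrite !mulrA axa.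
split; rewrite ?adE //.
by rewrite -mulrA adE -!(mulrA x) (mulrA (a * d)) ada.
Qed.

(** Self-adjoint idempotents with the same right ideal coincide: [(a y)(a d) = a d], and applying
    [star] gives [(a d)(a y) = a d], whose left side is also [a y]. *)
Lemma inner_hermitian_proj_uniq {R : pzRingType} {star : R -> R} {a y d : R} :
  ring_involution star ->
  a * y * a = a -> star (a * y) = a * y ->
  a * d * a = a -> star (a * d) = a * d -> a * y = a * d.
Proof.
move=> [_ _ sM] aya say ada sad.
have E : a * y * (a * d) = a * d by rewrite mulrA aya.
by rewrite -sad -E sM say sad mulrA ada.
Qed.

Lemma is_123_inverse_1MP {R : pzRingType} {star : R -> R} {a y : R} :
  ring_involution star -> MP_invertible star a ->
  is_123_inverse star a y -> is_1MP_inverse star a y.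
Proof.
(* [y] itself serves as the inner inverse: [y a d = y a y = y]. *)
move=> star_inv [d dP] [aya yay say]; exists y, d; split=> //.
case: dP => ada _ sad _.
rewrite -mulrA -(inner_hermitian_proj_uniq star_inv aya say ada sad).
by rewrite mulrA yay.
Qed.

Lemma le_1MP_refl {R : pzRingType} {star : R -> R} (a : R) :
  MP_invertible star a -> le_1MP star a a.
Proof.
case=> d dP; exists d; split=> //; exists d, d.
by case: (dP) => ada dad _ _; split=> //; rewrite dad.
Qed.

Lemma le_1MP_anti {R : pzRingType} {star : R -> R} (a b : R) :
  le_1MP star a b -> le_1MP star b a -> a = b.
Proof.
move=> [y [/is_1MP_inverse_123[aya _ _] ya _]].
move=> [z [/is_1MP_inverse_123[bzb _ _] zb bz]].
have aE : a = a * y * b by rewrite -mulrA -ya mulrA.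
have bE : b = a * z * a by rewrite -mulrA -zb mulrA -bz.
(* [a z a] is [b] by [bE], but also [(a y b) z a = a y (b z b) = a y b = a]. *)
by rewrite bE {2}aE -!mulrA -zb (mulrA b) bzb mulrA -aE.
Qed.

Lemma le_1MP_trans {R : pzRingType} {star : R -> R} (a b c : R) :
  ring_involution star -> MP_invertible star a ->
  le_1MP star a b -> le_1MP star b c -> le_1MP star a c.
Proof.
move=> star_inv aD [y [/is_1MP_inverse_123[aya yay say] ya ay]].
move=> [z [/is_1MP_inverse_123[bzb _ sbz] zb bz]].
have bz_ay : b * z * (a * y) = a * y by rewrite ay mulrA bzb.
have ay_bz : a * y * (b * z) = a * y.
  by have := congr1 star bz_ay; rewrite (starM star_inv) say sbz.
have az : a * z = a * y.
  by rewrite -[RHS]ay_bz mulrA -(mulrA a y b) -ya mulrA aya.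
have ayb : a * y * b = a by rewrite -mulrA -ya mulrA.
have aw : a * (z * a * y) = a * y by rewrite !mulrA az aya.
have wa : z * a * y * a = z * a by rewrite -!mulrA (mulrA a) aya.
exists (z * a * y); split.
- apply: is_123_inverse_1MP => //; split; rewrite ?aw //.
  by rewrite -mulrA aw -(mulrA (z * a)) (mulrA y) yay.
(* [(z a y) c = z a z c = z a z b = z a y b = z a]. *)
- rewrite wa -(mulrA z) -az -!mulrA -zb.
  by rewrite (mulrA a) az ayb.
(* [c (z a y) = c z b y = b z b y = b y = a y]. *)
- by rewrite aw -mulrA ay !mulrA -bz bzb.
Qed.

Theorem theorem4p3 (R : pzRingType) (star : R -> R)
    (star_inv : ring_involution star) :
  partial_order_on (MP_invertible star) (le_1MP star).
Proof.
split.
- exact: le_1MP_refl.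
- by move=> a b _ _; apply: le_1MP_anti.
- by move=> a b c aD _ _; apply: le_1MP_trans.
Qed.
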